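(* Let $B=\{b_1,\ldots,b_n\}\subseteq\mathbb{Z}^m$ be a supernormal configuration which generates $\mathbb{Z}^m$ as an abelian group, and let $A=\{a_1,\ldots,a_n\}\subseteq\mathbb{Z}^{n-m}$ be a Gale dual configuration. Then the map $$M\;\longmapsto\;\bigl\{\,\bar\sigma\subseteq\{1,\ldots,n\}\;:\;\langle x_i : i\in\bar\sigma\rangle \text{ is a minimal prime of } M\,\bigr\}$$ is a bijection from the set of virtual initial ideals of $J_B$ onto the set of virtual chambers of $B$.
   Context: $k$ is a field and $S=k[x_1,\ldots,x_n]$. For a finite set $C$ of real vectors, $\mathrm{cone}(C)$ is the set of non-negative real combinations of $C$. $B$ is supernormal if for every subset $B'\subseteq B$, every point of $\mathrm{cone}(B')\cap\mathbb{Z}^m$ is a non-negative integer combination of $B\cap\mathrm{cone}(B')$. $J_B\subseteq S$ is the ideal generated by the binomials $\prod_{i:\,u\cdot b_i>0}x_i^{u\cdot b_i}-\prod_{j:\,u\cdot b_j<0}x_j^{-u\cdot b_j}$, $u\in\mathbb{Z}^m$. Regard $B$ also as the $m\times n$ integer matrix with columns $b_i$. A Gale dual of $B$ is a configuration $A=\{a_1,\ldots,a_n\}\subseteq\mathbb{Z}^{n-m}$ such that the integer kernel $\{\lambda\in\mathbb{Z}^n:\sum_i\lambda_ia_i=0\}$ of the $(n-m)\times n$ matrix $(a_1,\ldots,a_n)$ is spanned (as a lattice) by the rows of the matrix $B$. Grade $S$ by $\deg x_i=a_i$; let $\mathbb{N}A$ be the monoid of non-negative integer combinations of $a_1,\ldots,a_n$.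 A monomial ideal $M\subseteq S$ is a virtual initial ideal of $J_B$ if for every $b\in\mathbb{N}A$ there is exactly one monomial of degree $b$ not in $M$ (equivalently, $S/M$ has the same multigraded Hilbert function as $S/J_B$). A triangulation of $A$ is a collection $\Delta$ of $(n-m)$-element subsets $\sigma\subseteq\{1,\ldots,n\}$ such that each $\{a_i:i\in\sigma\}$ is linearly independent and the simplicial cones $\mathrm{cone}(a_i:i\in\sigma)$, $\sigma\in\Delta$, together with all their faces, form a polyhedral fan whose union is $\mathrm{cone}(A)$. For a triangulation $\Delta$, the collection $\{\bar\sigma=\{1,\ldots,n\}\setminus\sigma : \sigma\in\Delta\}$ is called a virtual chamber of $B$.
   Formalization: Triangulations are taken in the labelled sense, cone(σ)∩cone(τ)=cone(σ∩τ) for all faces; the purely geometric fan condition also admits {{1},{2}} for B={1,-1}, A={1,1}, for which the map is not onto. *)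

(* Defs.v *)
From mathcomp Require Import all_boot all_order all_algebra.
From mathcomp Require Import boolp classical_sets functions reals.
From mathcomp Require Import mpoly.

Set Implicit Arguments.
Unset Strict Implicit.
Unset Printing Implicit Defensive.

Import GRing.Theory Num.Theory.

Local Open Scope classical_set_scope.
Local Open Scope ring_scope.

(* A vector configuration is an integer matrix whose columns are its vectors;
   subconfigurations are sets of column indices. *)

Definition real_col (R : realType) (d n : nat) (A : 'M[int]_(d, n))
    (i : 'I_n) : 'cV[R]_d :=
  map_mx intr (col i A).

Definition cone (R : realType) (d n : nat) (A : 'M[int]_(d, n))
    (s : {set 'I_n}) : set 'cV[R]_d :=
  [set v | exists c : 'I_n -> R,
     (forall i, 0 <= c i) /\ v = \sum_(i in s) c i *: real_col R A i].

Definition supernormal (R : realType) (m n : nat) (B : 'M[int]_(m, n)) : Prop :=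
  forall (s : {set 'I_n}) (z : 'cV[int]_m),
    cone B s (map_mx intr z : 'cV[R]_m) ->
    exists c : 'I_n -> nat,
      (forall i, ~ cone B s (real_col R B i) -> c i = 0%N) /\
      z = \sum_i col i B *+ c i.

Definition generates_lattice (m n : nat) (B : 'M[int]_(m, n)) : Prop :=
  forall z : 'cV[int]_m, exists l : 'cV[int]_n, z = B *m l.

Definition gale_dual (m n d : nat) (B : 'M[int]_(m, n)) (A : 'M[int]_(d, n)) :
    Prop :=
  forall l : 'cV[int]_n,
    A *m l = 0 <-> exists y : 'rV[int]_m, l^T = y *m B.

Definition is_ideal (S : comNzRingType) (I : set S) : Prop :=
  [/\ I 0,
      forall f g, I f -> I g -> I (f + g) &
      forall h f, I f -> I (h * f)].

Definition ideal_gen (S : comNzRingType) (G : set S) : set S :=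
  smallest (@is_ideal S) G.

Definition is_prime (S : comNzRingType) (P : set S) : Prop :=
  [/\ is_ideal P, ~ P 1 & forall f g, P (f * g) -> P f \/ P g].

Definition minimal_prime (S : comNzRingType) (I P : set S) : Prop :=
  [/\ is_prime P, I `<=` P &
      forall Q, is_prime Q -> I `<=` Q -> Q `<=` P -> Q = P].

Definition monomial_ideal (k : fieldType) (n : nat) (M : set {mpoly k[n]}) :
    Prop :=
  exists G : set 'X_{1..n}, M = ideal_gen [set 'X_[u] | u in G].

Definition var_ideal (k : fieldType) (n : nat) (s : {set 'I_n}) :
    set {mpoly k[n]} :=
  ideal_gen [set 'X_i | i in [set` s]].

Definition multideg (d n : nat) (A : 'M[int]_(d, n)) (u : 'X_{1..n}) :
    'cV[int]_d :=
  \sum_i col i A *+ u i.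

(* The lattice ideal J_B enters only through the grading of the polynomial ring
   by the Gale dual A: the range of [multideg A] is the monoid NA, and in each
   of its degrees the quotient by J_B has dimension one. *)
Definition virtual_initial_ideals (k : fieldType) (d n : nat)
    (A : 'M[int]_(d, n)) : set (set {mpoly k[n]}) :=
  [set M | monomial_ideal M /\
     forall b, range (multideg A) b ->
       exists! u : 'X_{1..n}, multideg A u = b /\ ~ M 'X_[u]].
Arguments virtual_initial_ideals k {d n} A.

Definition faces (n : nat) (D : {set {set 'I_n}}) : set {set 'I_n} :=
  [set t | exists2 s, s \in D & t \subset s].

(* Cones are labelled by their sets of generating indices, and two of them must
   meet in the face labelled by the common indices.  If no two vectors used lie
   on a common ray, this is the usual fan condition; otherwise it also rules out
   e.g. {{1}, {2}} when a_1 = a_2, where the underlying cones coincide. *)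
Definition triangulation (R : realType) (d n : nat) (A : 'M[int]_(d, n))
    (D : {set {set 'I_n}}) : Prop :=
  [/\ forall s, s \in D ->
        #|s| = d /\ free [seq real_col R A i | i <- enum s],
      forall s t, faces D s -> faces D t ->
        cone A s `&` cone A t = cone A (s :&: t)%SET :> set 'cV[R]_d &
      \bigcup_(s in [set` D]) cone A s = cone A [set: 'I_n]%SET :> set 'cV[R]_d].

Definition virtual_chambers (R : realType) (d n : nat) (A : 'M[int]_(d, n)) :
    set {set {set 'I_n}} :=
  [set [set (~: s)%SET | s in D]%SET | D in triangulation R A].

Definition var_minimal_primes (k : fieldType) (n : nat)
    (M : set {mpoly k[n]}) : {set {set 'I_n}} :=
  [set s | `[< minimal_prime M (var_ideal s) >]]%SET.

(* Main.v *)
(** Let [std] be the set of monomials outside a virtual initial ideal M: an order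
    ideal with exactly one element in each fibre of the grading.  The set of
    variables outside a minimal prime of M is a facet: a maximal [t] with
    N^t inside [std].
    - Facets triangulate: two distinct points over the same degree on two facets
      would give, by rational approximation, two standard monomials of one
      degree.  Taking multiples of a degree and extracting a subsequence whose
      exponents are constant or tend to infinity shows that the facets cover all
      of NA, and, with a further direction, that each of them spans.
    - Facets determine M: let x^h be the gcd of the monomials of a fibre.  After
      dividing by x^h, the rational point of the fibre on a simplicial cone is a
      vertex at which all constraints [b_j] in the dual cone are tight, hence it
      is integral by supernormality; the standard monomial of the fibre is
      x^h times the monomial of that vertex.
    - Conversely, for a triangulation this recipe defines an order ideal whose
      facets are the cones of the triangulation. *)

Require Import Defs.
From mathcomp Require Import all_boot all_order all_algebra.
From mathcomp Require Import boolp classical_sets functions reals.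
From mathcomp Require Import mpoly.

Set Implicit Arguments.
Unset Strict Implicit.
Unset Printing Implicit Defensive.

Import Order.TTheory GRing.Theory Num.Theory.

Local Open Scope ring_scope.

(** * Integer vectors in kernels of integer matrices *)

Lemma rat_mx_scale m n (Q : 'M[rat]_(m, n)) :
  exists N : nat, (0 < N)%N /\
    exists Z : 'M[int]_(m, n), map_mx intr Z = N%:R *: Q.
Proof.
pose D (p : 'I_m * 'I_n) := `|denq (Q p.1 p.2)|%N.
exists (\prod_p D p)%N; split.
  by apply: prodn_gt0 => p; rewrite absz_gt0 denq_neq0.
exists (\matrix_(i, j) (numq (Q i j) * (\prod_(p | p != (i, j)) D p)%N%:Z)).
apply/matrixP => i j; rewrite !mxE [in RHS](bigD1 (i, j)) //= intrM natrM.
by rewrite /D /= natr_absz normr_denq mulrAC [_%:~R * Q i j]mulrC -numqE.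
Qed.

Section Kernel.
Variable R : realType.

Local Notation realmx := (map_mx (intr : int -> R)).

(** The kernel is computed over the rationals, where denominators can be cleared; [kermx] commutes
    with the field extension to [R], so the same integer columns span the real kernel. *)
Lemma int_kernel p n (A : 'M[int]_(p, n)) :
  exists K : 'M[int]_n, A *m K = 0 /\
    forall x : 'cV[R]_n, realmx A *m x = 0 ->
      exists y : 'cV[R]_n, x = realmx K *m y.
Proof.
pose Aq : 'M[rat]_(n, p) := map_mx intr A^T.
have [N [N0 [Z ZE]]] := rat_mx_scale (kermx Aq).
have ZA : Z *m A^T = 0.
  have : map_mx intr (Z *m A^T) = 0 :> 'M[rat]__.
    by rewrite map_mxM ZE -scalemxAl mulmx_ker scaler0.
  move/matrixP=> Z0; apply/matrixP => i j.
  by move: (Z0 i j); rewrite !mxE => /eqP; rewrite intr_eq0 => /eqP.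
exists Z^T; split; first by rewrite -[A]trmxK -trmx_mul ZA trmx0.
move=> x Ax.
have AqR : map_mx ratr Aq = (realmx A)^T.
  by apply/matrixP => i j; rewrite !mxE ratr_int.
have xK : (x^T <= map_mx ratr (kermx Aq))%MS.
  by rewrite map_kermx AqR; apply/sub_kermxP; rewrite -trmx_mul Ax trmx0.
have [y xE] := submxP xK.
have NR : (N%:R : R) != 0 by rewrite pnatr_eq0 -lt0n.
exists (N%:R^-1 *: y^T); rewrite -[x]trmxK xE trmx_mul -scalemxAr scalemxAl.
congr (_ *m _).
have -> : realmx Z^T = (map_mx ratr (map_mx intr Z : 'M[rat]_n))^T.
  by apply/matrixP => i j; rewrite !mxE ratr_int.
rewrite ZE; apply/matrixP => i j.
by rewrite !mxE rmorphM /= ratr_nat mulKf.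
Qed.

Lemma eventually_forall (I : finType) (P : I -> nat -> Prop) :
  (forall i, exists N0, forall N, (N0 <= N)%N -> P i N) ->
  exists N0, forall N, (N0 <= N)%N -> forall i, P i N.
Proof.
move=> /choice[f fP]; exists (\max_i f i)%N => N fN i.
by apply: fP; apply: leq_trans fN; apply: leq_bigmax.
Qed.

Lemma sum_le_archi (a C : R) : 0 < a ->
  exists N0, forall N, (N0 <= N)%N -> C < N%:R * a.
Proof.
move=> a0; have [N0 hN] : exists N0 : nat, C / a < N0%:R.
  exists (Num.bound `|C / a|).
  by apply: le_lt_trans (ler_norm _) (archi_boundP _).
exists N0 => N N0N; rewrite -ltr_pdivrMr //.
by apply: lt_le_trans hN _; rewrite ler_nat.
Qed.

(** Write [x] as a real combination of integer kernel vectors, scale by a large [N] and round the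
    coefficients: the error stays bounded in [N], so nonzero coordinates keep their sign. *)
Lemma int_kernel_sign p n (A : 'M[int]_(p, n)) (x : 'cV[R]_n) :
  realmx A *m x = 0 ->
  exists z : 'cV[int]_n, A *m z = 0 /\
    forall i, Num.sg (z i 0)%:~R = Num.sg (x i 0).
Proof.
move=> Ax.
(* Stacking [E] under [A] forces the coordinates where [x] vanishes to stay exactly zero after
   rounding. *)
pose E : 'M[int]_n := diag_mx (\row_i (x i 0 == 0)%:R).
have EE (S : nzRingType) (f : {rmorphism int -> S}) (v : 'cV[S]_n) i :
    (map_mx f E *m v) i 0 = (x i 0 == 0)%:R * v i 0.
  rewrite mxE (bigD1 i) //= big1 ?addr0.
    by rewrite !mxE eqxx mulr1n rmorph_nat.
  by move=> j /negPf ji; rewrite !mxE [i == j]eq_sym ji mulr0n rmorph0 mul0r.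
have [K [AK xK]] := int_kernel (col_mx A E).
have [|y xE] := xK x.
  rewrite map_col_mx mul_col_mx Ax -[RHS]col_mx0; congr col_mx.
  apply/matrixP => i j; rewrite ord1 EE mxE.
  by case: eqVneq => [->|]; rewrite ?mulr0 ?mul0r.
have [AK0 EK0] : A *m K = 0 /\ E *m K = 0.
  by apply: eq_col_mx; rewrite col_mx0 -mul_col_mx.
pose z N : 'cV[int]_n := K *m (\col_j Num.floor (N%:R * y j 0)).
have zE N i : `|(z N i 0)%:~R - N%:R * x i 0| <= \sum_j `|(K i j)%:~R : R|.
  rewrite xE !mxE mulr_sumr rmorph_sum /= -sumrB.
  apply: le_trans (ler_norm_sum _ _ _) _; apply: ler_sum => j _.
  rewrite !mxE rmorphM /= mulrCA -mulrBr normrM ler_piMr //.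
  have /andP[h1 h2] := floor_itv (N%:R * y j 0).
  rewrite ler_norml lerBlDr lerBrDr [-1 + _]addrC lerBlDr.
  by rewrite (le_trans h1) ?lerDr// andbT ltW// -[1]/(1%:~R) -intrD.
have sgzE i : exists N0, forall N, (N0 <= N)%N ->
    Num.sg (z N i 0)%:~R = Num.sg (x i 0).
  have [x0|xn0] := eqVneq (x i 0) 0.
    exists 0%N => N _; rewrite x0; congr (Num.sg _).
    have : E *m z N = 0 by rewrite mulmxA EK0 mul0mx.
    move/matrixP/(_ i 0); rewrite -[E](map_mx_id (fun _ => erefl)).
    by rewrite (EE _ idfun) x0 eqxx mul1r [RHS]mxE => ->.
  have [N0 hN] := @sum_le_archi `|x i 0| (\sum_j `|(K i j)%:~R : R|)
    ltac:(by rewrite normr_gt0).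
  exists N0 => N /hN {}hN; have := le_lt_trans (zE N i) hN.
  case: (ltrgt0P (x i 0)) xn0 => // x0 _.
    rewrite ltr_norml => /andP[h _].
    by rewrite !gtr0_sg //; rewrite -(ltrD2r (- (N%:R * x i 0))) add0r.
  rewrite mulrN ltr_norml => /andP[_ h].
  by rewrite !ltr0_sg //; rewrite -(ltrD2r (- (N%:R * x i 0))) add0r.
have [N0 hN] := eventually_forall sgzE.
exists (z N0); split; first by rewrite mulmxA AK0 mul0mx.
exact: hN.
Qed.

End Kernel.

(** * Simplicial cones and separating functionals *)

Definition csupported (R : realType) n (s : {set 'I_n}) (c : 'cV[R]_n) :=
  forall i, i \notin s -> c i 0 = 0.

Definition nonneg (R : realType) n (c : 'cV[R]_n) := forall i, 0 <= c i 0.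

Definition mask (R : realType) n (s : {set 'I_n}) (c : 'cV[R]_n) : 'cV[R]_n :=
  \col_i (if i \in s then c i 0 else 0).

Lemma mask_supported (R : realType) n (s : {set 'I_n}) (c : 'cV[R]_n) :
  csupported s (mask s c).
Proof. by move=> i /negPf is_; rewrite mxE is_. Qed.

Lemma mask_id (R : realType) n (s : {set 'I_n}) (c : 'cV[R]_n) :
  csupported s c -> mask s c = c.
Proof.
by move=> sc; apply/colP => i; rewrite mxE; case: ifPn => // /sc.
Qed.

Lemma csupportedB (R : realType) n (s : {set 'I_n}) (c c' : 'cV[R]_n) :
  csupported s c -> csupported s c' -> csupported s (c - c').
Proof. by move=> sc sc' i ins; rewrite !mxE sc // sc' // subr0. Qed.

Lemma csupportedW (R : realType) n (s t : {set 'I_n}) (c : 'cV[R]_n) :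
  s \subset t -> csupported s c -> csupported t c.
Proof. by move=> /fintype.subsetP st sc i; move/(contra (st i)) => /sc. Qed.

(** For [v] outside the span, [v^T] times the cokernel matrix has a nonzero entry; the column of
    that entry, normalised, is the functional. *)
Lemma span_separation (R : realType) d n (Q : 'M[R]_(d, n)) (s : {set 'I_n})
    (v : 'cV[R]_d) :
  (exists c, csupported s c /\ v = Q *m c) \/
  exists f : 'rV[R]_d,
    (forall c, csupported s c -> (f *m (Q *m c)) 0 0 = 0) /\ (f *m v) 0 0 = 1.
Proof.
pose X := Q *m diag_mx (\row_i (i \in s)%:R).
have XE c : X *m c = Q *m mask s c.
  rewrite -mulmxA; congr (_ *m _); apply/colP => i.
  rewrite mxE (bigD1 i) //= big1 ?addr0 => [|j ji].
    by rewrite !mxE eqxx mulr1n; case: ifP; rewrite ?mul1r ?mul0r.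
  by rewrite !mxE [i == j]eq_sym (negPf ji) mulr0n mul0r.
have [/submxP[c vE]|nvX] := boolP (v^T <= X^T)%MS; [left|right].
  exists (mask s c^T); split; first exact: mask_supported.
  by rewrite -XE -[v]trmxK vE trmx_mul trmxK.
move: nvX; rewrite submxE => /matrix0Pn[i [j]]; rewrite ord1 => vj.
pose g := (col j (cokermx X^T))^T.
have gX : g *m X = 0.
  by rewrite -[X]trmxK -trmx_mul /g colE mulmxA mulmx_coker mul0mx trmx0.
have gv : (g *m v) 0 0 = (v^T *m cokermx X^T) 0 j.
  by rewrite -[v in LHS]trmxK -trmx_mul /g colE mulmxA -colE !mxE.
exists (((v^T *m cokermx X^T) 0 j)^-1 *: g); split=> [c sc|].
  rewrite -(mask_id sc) -XE mulmxA -scalemxAl gX scaler0.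
  by rewrite mul0mx mxE.
by rewrite -scalemxAl mxE gv mulVf.
Qed.

Section Cones.
Variables (R : realType) (d n : nat) (A : 'M[int]_(d, n)).
Local Notation AR := (map_mx (intr : int -> R) A).

Lemma sum_real_cols (s : {set 'I_n}) (c : 'I_n -> R) :
  \sum_(i in s) c i *: real_col R A i = AR *m mask s (\col_i c i).
Proof.
apply/colP => k; rewrite !mxE summxE big_mkcond /=; apply: eq_bigr => i _.
by rewrite !mxE; case: ifP; rewrite ?mulr0 // mulrC.
Qed.

Lemma coneP (s : {set 'I_n}) (v : 'cV[R]_d) :
  cone A s v <->
  exists c : 'cV[R]_n, [/\ nonneg c, csupported s c & v = AR *m c].
Proof.
split=> [[c [c0 ->]]|[c [c0 sc ->]]].
  exists (mask s (\col_i c i)); rewrite sum_real_cols.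
  split=> //; last exact: mask_supported.
  by move=> i; rewrite !mxE; case: ifP.
exists (fun i => c i 0); split=> //; rewrite sum_real_cols.
congr (_ *m _); rewrite -[LHS](mask_id sc); congr mask.
by apply/colP => i; rewrite mxE.
Qed.

Lemma free_colsP (s : {set 'I_n}) :
  free [seq real_col R A i | i <- enum s] <->
  (forall c : 'cV[R]_n, csupported s c -> AR *m c = 0 -> c = 0).
Proof.
pose X := map_tuple (real_col R A) (enum_tuple s).
have XE (k : 'I_#|s|) : X`_k = real_col R A (enum_val k).
  by rewrite (nth_map (enum_val k)) -?cardE // -enum_val_nth.
have sumE (c : 'I_n -> R) :
    \sum_(k < #|s|) c (enum_val k) *: X`_k = AR *m mask s (\col_i c i).
  rewrite -sum_real_cols [RHS]big_enum_val /=.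
  by apply: eq_bigr => k _; rewrite XE.
split=> [/(@freeP _ _ _ X) fX c sc Ac|H].
  have := fX (fun k => c (enum_val k) 0).
  rewrite (sumE (fun i => c i 0)) => h.
  have cE : \col_i c i 0 = c by apply/colP => i; rewrite mxE.
  rewrite cE (mask_id sc) in h; apply/colP => i; rewrite [RHS]mxE.
  have [si|/sc//] := boolP (i \in s).
  by have := h Ac (enum_rank_in si i); rewrite enum_rankK_in.
apply/(@freeP _ _ _ X) => c cX k.
(* Extends [c] to all indices; its values outside [s] are arbitrary and removed by [mask]. *)
pose e i := c (enum_rank_in (enum_valP k) i).
have eE j : e (enum_val j) = c j by rewrite /e enum_valK_in.
have := H (mask s (\col_i e i)) (@mask_supported _ _ _ _).
rewrite -sumE; under eq_bigr do rewrite eE.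
move=> /(_ cX)/colP/(_ (enum_val k)).
by rewrite !mxE enum_valP eE.
Qed.

(** The cone is simplicial. If [b] is off its span, a functional vanishing on the span separates.
    Otherwise some coordinate of [b] is negative, and that coordinate extends to the whole space. *)
Lemma cone_separation (s : {set 'I_n}) (b : 'cV[R]_d) :
  free [seq real_col R A i | i <- enum s] -> ~ cone A s b ->
  exists f : 'rV[R]_d,
    (forall c, nonneg c -> csupported s c -> 0 <= (f *m (AR *m c)) 0 0) /\
    (f *m b) 0 0 < 0.
Proof.
move=> /free_colsP fs nb.
have [[c [sc bE]]|[f [f0 f1]]] := span_separation AR s b; last first.
  exists (- f); split=> [c _ sc|]; first by rewrite mulNmx mxE f0 // oppr0.
  by rewrite mulNmx mxE f1 ltrN10.
have [i ci] : exists i, c i 0 < 0.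
  apply: contrapT => h; apply: nb; apply/coneP; exists c; split=> // i.
  by rewrite leNgt; apply/negP => ci; apply: h; exists i.
have si : i \in s by apply: contraTT ci => /sc ->; rewrite ltxx.
pose e : 'cV[R]_n := delta_mx i 0.
have [[c' [sc' eE]]|[f [f0 f1]]] := span_separation AR (s :\ i) (AR *m e).
  have /colP/(_ i) : e - c' = 0.
    apply: fs; last by rewrite mulmxBr -eE subrr.
    apply: csupportedB; last by apply: csupportedW sc'; rewrite subD1set.
    by move=> j js; rewrite mxE andbT; case: eqP js => // ->; rewrite si.
  rewrite !mxE !eqxx sc' ?subr0; first by move/eqP; rewrite oner_eq0.
  by rewrite !inE eqxx.
have fE x : csupported s x -> (f *m (AR *m x)) 0 0 = x i 0.
  move=> sx; have -> : x = x i 0 *: e + mask (s :\ i) x.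
    apply/colP => j; rewrite !mxE andbT !inE; case: eqVneq => [->|_] /=.
      by rewrite mulr1 addr0.
    by rewrite mulr0 add0r; case: ifPn => // /sx.
  rewrite mulmxDr mulmxDr -!scalemxAr mxE mxE f1 f0 ?addr0.
    by rewrite !mxE !eqxx !inE eqxx addr0.
  exact: mask_supported.
exists f; split=> [x x0 sx|]; first by rewrite fE.
by rewrite bE fE.
Qed.

End Cones.

(** * Limits in order ideals of monomials *)

(** Subsequences are encoded as infinite sets of indices; extracting one means shrinking the set. *)
Definition unbounded (S : nat -> Prop) := forall N, exists K, (N < K)%N /\ S K.

Definition diverges_on (S : nat -> Prop) (g : nat -> nat) :=
  forall N, exists K0, forall K, (K0 < K)%N -> S K -> (N <= g K)%N.

(** If no value recurs infinitely often, every value is eventually left behind and [S] itself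
    serves. *)
Lemma constant_or_divergent (S : nat -> Prop) (g : nat -> nat) :
  unbounded S ->
  exists S', [/\ unbounded S', forall K, S' K -> S K &
    (exists a, forall K, S' K -> g K = a) \/ diverges_on S' g].
Proof.
move=> uS.
have [[a ua]|na] := pselect (exists a, unbounded (fun K => S K /\ g K = a)).
  exists (fun K => S K /\ g K = a); split=> // [K []//|].
  by left; exists a => K [].
exists S; split=> //; right; elim=> [|N [K0 hK0]]; first by exists 0%N.
have /existsNP[K1 hK1] : ~ unbounded (fun K => S K /\ g K = N).
  by move=> h; apply: na; exists N.
exists (maxn K0 K1) => K; rewrite gtn_max => /andP[K0K K1K] SK.
rewrite ltn_neqAle hK0 // andbT; apply/eqP => gK.
by apply: hK1; exists K.
Qed.

Lemma constant_or_divergent_seq (I : eqType) (f : nat -> I -> nat) (r : seq I)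
    (S : nat -> Prop) :
  unbounded S ->
  exists S', [/\ unbounded S', forall K, S' K -> S K & forall i, i \in r ->
    (exists a, forall K, S' K -> f K i = a) \/ diverges_on S' (f^~ i)].
Proof.
move=> uS; elim: r => [|j r [S1 [u1 s1 h1]]]; first by exists S.
have [S2 [u2 s2 h2]] := constant_or_divergent (f^~ j) u1.
exists S2; split=> // [K /s2/s1//|i]; rewrite inE => /predU1P[->//|/h1[[a ha]|di]].
  by left; exists a => K /s2/ha.
right=> N; have [K0 hK0] := di N.
by exists K0 => K K0K /s2; apply: hK0.
Qed.

Definition supported n (s : {set 'I_n}) (u : 'X_{1..n}) :=
  forall i, i \notin s -> u i = 0%N.

Lemma supportedW n (s t : {set 'I_n}) (u : 'X_{1..n}) :
  s \subset t -> supported s u -> supported t u.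
Proof. by move=> /fintype.subsetP st sc i; move/(contra (st i)) => /sc. Qed.

Definition order_ideal n (std : 'X_{1..n} -> Prop) :=
  forall u v, std (u + v)%MM -> std u.

Lemma order_idealP n (std : 'X_{1..n} -> Prop) (u v : 'X_{1..n}) :
  order_ideal std -> (forall i, (u i <= v i)%N) -> std v -> std u.
Proof.
move=> dst /mnm_lepP uv; rewrite -(submK uv) addmC; exact: dst.
Qed.

(** Along a suitable subsequence each exponent is constant or diverges: [t] collects the divergent
    indices, [w] the constant values, and every [w + p] divides a late term. The last clause gives
    differences of terms living on [t], from which relations between degrees are read off. *)
Lemma order_ideal_limit n (std : 'X_{1..n} -> Prop) (f : nat -> 'X_{1..n}) :
  order_ideal std -> (forall K, std (f K)) ->
  exists (t : {set 'I_n}) (w : 'X_{1..n}),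
    [/\ supported (~: t)%SET w,
        forall p, supported t p -> std (w + p)%MM &
        forall N, exists K1 K2, [/\ (N < K1 < K2)%N,
          forall i, i \notin t -> f K1 i = w i &
          exists2 p, supported t p & f K2 = (f K1 + p)%MM]].
Proof.
move=> dst fstd.
have [|S [uS _ hS]] := @constant_or_divergent_seq 'I_n f (enum 'I_n) (fun _ => True).
  by move=> N; exists N.+1.
pose t : {set 'I_n} := [set i | `[< diverges_on S (f^~ i) >]]%SET.
have /choice[w hw] : forall i, exists a, i \notin t -> forall K, S K -> f K i = a.
  move=> i; have [[a ha]|di] := hS i (mem_enum _ _); first by exists a.
  by exists 0%N; rewrite inE; case: asboolP.
have div N : exists K0, forall K, (K0 < K)%N -> S K ->
    forall i, i \in t -> (N i <= f K i)%N.
  have [|K0 hK0] := @eventually_forall 'I_n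
      (fun i K => S K -> i \in t -> N i <= f K i)%N.
    move=> i; have [it|nit] := boolP (i \in t); last by exists 0%N.
    move: (it); rewrite inE => /asboolP/(_ (N i))[K0 hK0].
    by exists K0.+1 => K K0K SK _; apply: hK0.
  by exists K0 => K /ltnW K0K SK i it; apply: hK0.
(* The chosen [w] is unconstrained on [t], so it is reset to zero there. *)
pose w' : 'X_{1..n} := [multinom (if i \in t then 0%N else w i) | i < n].
exists t, w'; split=> [i|p tp|N].
- by rewrite inE negbK => it; rewrite mnmE it.
- have [K0 hK0] := div p; have [K [K0K SK]] := uS K0.
  apply: order_idealP (fstd K) => // i; rewrite mnmDE mnmE.
  case: ifPn => it; first by rewrite add0n hK0.
  by rewrite tp // addn0 (hw i it K SK).
have [K1 [NK1 SK1]] := uS N.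
(* [K2] is taken late enough for [f K2] to dominate [f K1] on [t]. *)
have [K0 hK0] := div (f K1).
have [K2 [K02 SK2]] := uS (maxn K0 K1).
move: K02; rewrite gtn_max => /andP[K02 K12].
exists K1, K2; split; first by rewrite NK1.
- by move=> i it; rewrite mnmE (negPf it) (hw i it K1 SK1).
- exists (f K2 - f K1)%MM => [i it|].
    by rewrite mnmBE (hw i it K1) // (hw i it K2) // subnn.
  apply/mnmP => i; rewrite mnmDE mnmBE addnC subnK //.
  have [it|it] := boolP (i \in t); first by apply: hK0.
  by rewrite (hw i it K1) // (hw i it K2).
Qed.

(** * The grading and its extension to real exponents *)

Section Multidegree.
Variables (R : realType) (d n : nat) (A : 'M[int]_(d, n)).
Local Notation AR := (map_mx (intr : int -> R) A).

Definition mcol (u : 'X_{1..n}) : 'cV[R]_n := \col_i (u i)%:R.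

Lemma mcolD u v : mcol (u + v)%MM = mcol u + mcol v.
Proof. by apply/colP => i; rewrite !mxE mnmDE natrD. Qed.

Lemma mcol_nonneg u : nonneg (mcol u).
Proof. by move=> i; rewrite mxE ler0n. Qed.

Lemma mcol_supported s u : supported s u -> csupported s (mcol u).
Proof. by move=> su i /su ui; rewrite mxE ui. Qed.

Lemma mcol_inj : injective mcol.
Proof.
move=> u v /colP uv; apply/mnmP => i; move: (uv i); rewrite !mxE => /eqP.
by rewrite eqr_nat => /eqP.
Qed.

Lemma multidegE u : multideg A u = A *m \col_i (u i)%:Z.
Proof.
apply/colP => k; rewrite summxE mxE; apply: eq_bigr => i _.
by rewrite mulmxnE !mxE -mulr_natr natz.
Qed.

Lemma multidegD u v : multideg A (u + v)%MM = multideg A u + multideg A v.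
Proof.
rewrite !multidegE -mulmxDr; congr (_ *m _); apply/colP => i.
by rewrite !mxE mnmDE.
Qed.

Lemma multidegMn u k : multideg A (u *+ k)%MM = multideg A u *+ k.
Proof.
elim: k => [|k IH]; last by rewrite mulmS multidegD IH mulrS.
rewrite mulr0n multidegE -[RHS](mulmx0 _ A); congr (_ *m _).
by apply/colP => i; rewrite !mxE mulm0n mnm0E.
Qed.

Lemma real_multideg u : map_mx intr (multideg A u) = AR *m mcol u.
Proof.
rewrite multidegE map_mxM; congr (_ *m _); apply/colP => i.
by rewrite !mxE.
Qed.

Lemma multideg_realP u v :
  multideg A u = multideg A v <-> AR *m mcol u = AR *m mcol v.
Proof.
rewrite -!real_multideg; split=> [->//|/matrixP uv].
apply/matrixP => i j; move: (uv i j); rewrite !mxE.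
exact: intr_inj.
Qed.

End Multidegree.

(** * The fan of a virtual initial ideal *)

Lemma maxset_above n (P : {set 'I_n} -> Prop) (t : {set 'I_n}) :
  P t -> exists2 t', maxset (fun s => `[< P s >]) t' & t \subset t'.
Proof.
move=> Pt; have [|t' mt' tt'] := @maxset_exists _ (fun s => `[< P s >]) t.
  exact/asboolP.
by exists t'.
Qed.

(** The faces of the simplicial complex of the radical of M: by [sub_var_ideal], the complements of
    the sets of variables whose ideal contains M. *)
Definition std_face n (std : 'X_{1..n} -> Prop) (t : {set 'I_n}) :=
  forall u, supported t u -> std u.

Definition facets n (std : 'X_{1..n} -> Prop) : {set {set 'I_n}} :=
  [set t | maxset (fun s => `[< std_face std s >]) t]%SET.

Lemma facetsP n (std : 'X_{1..n} -> Prop) (t : {set 'I_n}) :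
  reflect (std_face std t /\
           forall t', std_face std t' -> t \subset t' -> t' = t)
          (t \in facets std).
Proof.
rewrite inE; apply: (iffP maxsetP) => -[/asboolP ft mt]; split=> //.
  by move=> t' /asboolP; apply: mt.
by move=> t' /asboolP; apply: mt.
Qed.

Lemma facet_above n (std : 'X_{1..n} -> Prop) (t : {set 'I_n}) :
  std_face std t -> exists2 t', t' \in facets std & t \subset t'.
Proof. by move=> /maxset_above[t' mt' tt']; exists t' => //; rewrite inE. Qed.

(** What is left of a virtual initial ideal when only its standard monomials are kept;
    [virtual_initial_std] and [virtual_initial_of_std] translate between the two. *)
Definition virtual_std d n (A : 'M[int]_(d, n)) (std : 'X_{1..n} -> Prop) :=
  [/\ order_ideal std,
      forall u, exists v, multideg A v = multideg A u /\ std v &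
      forall u v, std u -> std v -> multideg A u = multideg A v -> u = v].

Lemma cone_subset (R : realType) d n (A : 'M[int]_(d, n))
    (s t : {set 'I_n}) (v : 'cV[R]_d) :
  s \subset t -> cone A s v -> cone A t v.
Proof.
move=> st /coneP[c [c0 sc vE]]; apply/coneP; exists c; split=> //.
exact: csupportedW sc.
Qed.

Section VirtualFan.
Variables (R : realType) (d n : nat) (A : 'M[int]_(d, n)).
Variable std : 'X_{1..n} -> Prop.
Hypothesis std_virtual : virtual_std A std.
Local Notation AR := (map_mx (intr : int -> R) A).

(** Replace [c - c'] by an integer kernel vector [z] with the same signs. Its positive part is
    supported on [s] and its negative part on [t], so both are standard, of equal degree, hence
    equal. So [z] vanishes, and [c - c'] with it. *)
Lemma std_faces_conflict (s t : {set 'I_n}) (c c' : 'cV[R]_n) :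
  std_face std s -> std_face std t -> nonneg c -> nonneg c' ->
  csupported s c -> csupported t c' -> AR *m c = AR *m c' -> c = c'.
Proof.
have [_ _ stdU] := std_virtual.
move=> fs ft c0 c'0 sc tc' Acc'.
have [|z [Az zs]] := @int_kernel_sign R _ _ A (c - c').
  by rewrite mulmxBr Acc' subrr.
pose p i := if 0 <= z i 0 then absz (z i 0) else 0%N.
pose q i := if 0 <= z i 0 then 0%N else absz (z i 0).
pose u : 'X_{1..n} := [multinom p i | i < n].
pose v : 'X_{1..n} := [multinom q i | i < n].
have uvz i : (u i)%:Z - (v i)%:Z = z i 0.
  rewrite !mnmE /p /q; case: (lerP 0 (z i 0)) => zi.
    by rewrite subr0 abszE ger0_norm.
  by rewrite sub0r abszE ltr0_norm // opprK.
have zsE i : Num.sg ((z i 0)%:~R : R) = (Num.sg (z i 0))%:~R.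
  by rewrite intr_sg.
have uv : u = v.
  apply: stdU.
  - apply: fs => i si; rewrite mnmE /p /q; case: ifP => // zi.
    have := zs i; rewrite zsE !mxE sc // sub0r sgrN => h.
    have : Num.sg (z i 0) <= 0.
      by rewrite -(ler_int R) h oppr_le0 sgr_ge0.
    by rewrite sgr_le0 => zi'; apply/eqP; rewrite absz_eq0 eq_le zi zi'.
  - apply: ft => i ti; rewrite mnmE /p /q; case: ifP => // zi.
    have := zs i; rewrite zsE !mxE tc' // subr0 => h.
    have : 0 <= Num.sg (z i 0) by rewrite -(ler_int R) h sgr_ge0.
    by rewrite sgr_ge0 zi.
  - rewrite !multidegE; apply/eqP; rewrite -subr_eq0 -mulmxBr; apply/eqP.
    rewrite -[RHS]Az; congr (_ *m _); apply/colP => i.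
    by rewrite [LHS]mxE [X in X + _]mxE [X in _ + X]mxE [X in _ - X]mxE uvz.
apply/colP => i; apply/eqP; rewrite -subr_eq0 -sgr_eq0.
by move: (zs i); rewrite -uvz uv subrr sgr0 !mxE => <-.
Qed.

Lemma std_face_free (t : {set 'I_n}) :
  std_face std t -> free [seq real_col R A i | i <- enum t].
Proof.
move=> ft; apply/free_colsP => c tc Ac.
(* [|c|] and [|c| - c] are non-negative points of the same face over the same degree. *)
pose c1 : 'cV[R]_n := \col_i `|c i 0|.
have tc1 : csupported t c1 by move=> i /tc ci; rewrite mxE ci normr0.
have : c1 = c1 - c.
  apply: (std_faces_conflict ft ft _ _ tc1 (csupportedB tc1 tc)).
  - by move=> i; rewrite mxE.
  - by move=> i; rewrite !mxE subr_ge0 ler_norm.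
  - by rewrite mulmxBr Ac subr0.
by move/eqP; rewrite eq_sym -subr_eq0 addrAC subrr add0r oppr_eq0 => /eqP.
Qed.

Lemma std_faces_meet (s t : {set 'I_n}) :
  std_face std s -> std_face std t ->
  (cone A s `&` cone A t = cone A (s :&: t)%SET :> set 'cV[R]_d)%classic.
Proof.
move=> fs ft; apply/seteqP; split=> v.
  move=> [/coneP[c [c0 sc ->]] /coneP[c' [c'0 tc' AE]]].
  apply/coneP; exists c; split=> // i; rewrite inE negb_and => /orP[/sc//|].
  by rewrite (std_faces_conflict fs ft c0 c'0 sc tc' AE) => /tc'.
by move=> h; split; apply: cone_subset h; rewrite ?subsetIl ?subsetIr.
Qed.

(** Among the standard representatives of the multiples of [u], two differ by an exponent [p] on a
    face, and the degree of [p] is a positive multiple of that of [u]. *)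
Lemma std_faces_cover_lattice (u : 'X_{1..n}) :
  exists2 t, t \in facets std & cone A t (AR *m mcol R u).
Proof.
have [dst stdE _] := std_virtual.
have /choice[f fP] K := stdE (u *+ K)%MM.
have [t [w [_ wt lim]]] := order_ideal_limit dst (fun K => (fP K).2).
have ft : std_face std t by move=> p /wt; rewrite addmC; apply: dst.
have [t' ft' tt'] := facet_above ft; exists t' => //.
apply: cone_subset tt' _.
have [K1 [K2 [/andP[_ K12] _ [p tp fE]]]] := lim 0%N.
have K0 : (0 : R) < (K2 - K1)%:R by rewrite ltr0n subn_gt0.
apply/coneP; exists ((K2 - K1)%:R^-1 *: mcol R p); split.
- by move=> i; rewrite !mxE mulr_ge0 ?invr_ge0 ?ler0n.
- by move=> i it; rewrite mxE (mcol_supported R tp it) mulr0.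
rewrite -scalemxAr -!real_multideg.
have -> : multideg A p = multideg A u *+ (K2 - K1).
  have := (fP K2).1; rewrite fE multidegD (fP K1).1 !multidegMn => h.
  apply: (addrI (multideg A u *+ K1)).
  by rewrite h -mulrnDr subnKC // ltnW.
by rewrite raddfMn /= -scaler_nat scalerA mulVf ?scale1r ?gt_eqF.
Qed.

(** If [b] were missed, finitely many functionals would separate it from all facet cones. Rounding
    the coefficients of [N b] moves each functional by a bounded amount, so for large [N] a lattice
    degree would be missed too. *)
Lemma std_faces_cover (b : 'cV[R]_d) :
  cone A [set: 'I_n]%SET b -> exists2 t, t \in facets std & cone A t b.
Proof.
move=> /coneP[c [c0 _ bE]]; apply: contrapT => nb.
have /choice[f fP] : forall t, exists f : 'rV[R]_d, t \in facets std ->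
    (forall c, nonneg c -> csupported t c -> 0 <= (f *m (AR *m c)) 0 0) /\
    (f *m b) 0 0 < 0.
  move=> t; have [ft|_] := boolP (t \in facets std); last by exists 0.
  have [|h|f hf] := @cone_separation R d n A t b.
  - by apply: std_face_free; case/facetsP: ft.
  - by apply: nb; exists t.
  - by exists f.
pose a N i := Num.truncn (N%:R * c i 0).
pose u N : 'X_{1..n} := [multinom a N i | i < n].
have [|N hN] := @eventually_forall _ (fun t N => t \in facets std ->
    (f t *m (AR *m mcol R (u N))) 0 0 < 0).
  move=> t; have [ft|_] := boolP (t \in facets std); last by exists 0%N.
  have [_ fb] := fP _ ft.
  have [|N0 hN0] := @sum_le_archi R (- (f t *m b) 0 0)
      (\sum_i `|(f t *m AR) 0 i|); first by rewrite oppr_gt0.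
  exists N0 => N /hN0 {}hN0 _.
  have -> : mcol R (u N) = N%:R *: c + (mcol R (u N) - N%:R *: c).
    by rewrite addrC subrK.
  rewrite mulmxDr mulmxDr -!scalemxAr -bE mxE [X in X + _]mxE.
  rewrite -ltrBrDl sub0r -mulrN; apply: le_lt_trans hN0.
  rewrite mulmxA mxE; apply: ler_sum => i _.
  apply: le_trans (ler_norm _) _; rewrite normrM ler_piMr // !mxE mnmE.
  have Nc : 0 <= N%:R * c i 0 by rewrite mulr_ge0.
  have /andP[h1 h2] := truncn_itv Nc.
  by rewrite distrC ger0_norm ?subr_ge0 // lerBlDl -natr1 in h2 *; exact: ltW.
have [t ft] := std_faces_cover_lattice (u N).
move=> /coneP[c' [c'0 tc' cE]].
have [/(_ _ c'0 tc') + _] := fP _ ft.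
by rewrite -cE leNgt hN.
Qed.

End VirtualFan.

(** * Facets span the whole space *)

Definition ones n (t : {set 'I_n}) : 'X_{1..n} :=
  [multinom nat_of_bool (i \in t) | i < n].

Definition mrestrict n (t : {set 'I_n}) (u : 'X_{1..n}) : 'X_{1..n} :=
  [multinom (if i \in t then u i else 0%N) | i < n].

Lemma mrestrict_supported n (t : {set 'I_n}) (u : 'X_{1..n}) :
  supported t (mrestrict t u).
Proof. by move=> i /negPf it; rewrite mnmE it. Qed.

Lemma ones_supported n (t : {set 'I_n}) k : supported t (ones t *+ k)%MM.
Proof. by move=> i /negPf it; rewrite mulmnE mnmE it mul0n. Qed.

Section FacetSpan.
Variables (R : realType) (d n : nat) (A : 'M[int]_(d, n)).
Variable std : 'X_{1..n} -> Prop.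
Hypothesis std_virtual : virtual_std A std.
Local Notation AR := (map_mx (intr : int -> R) A).

(* The degrees [K * sum_(i in t) a_i + j * a_i], with [K] growing, push the
   standard monomials into a translate of the facet [t]. *)
Lemma facet_translate (t : {set 'I_n}) (i : 'I_n) (j : nat) :
  t \in facets std ->
  exists w, [/\ supported (~: t)%SET w,
    forall p, supported t p -> std (w + p)%MM &
    exists c, csupported t c /\
      AR *m mcol R w = j%:R *: (AR *m mcol R U_(i)%MM) + AR *m c].
Proof.
have [dst stdE stdU] := std_virtual.
move=> /facetsP[ft mt].
have /choice[f fP] K := stdE (ones t *+ K + U_(i) *+ j)%MM.
have [t' [w [sw wt lim]]] := order_ideal_limit dst (fun K => (fP K).2).
have ft' : std_face std t' by move=> p /wt; rewrite addmC; apply: dst.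
have [K1 [K2 [/andP[_ K12] fw [p tp fE]]]] := lim 0%N.
(* Both sides are standard and of the same degree. As [K1 < K2], the exponent is positive on all of
   [t], so [t] lies in [t'] and maximality makes them equal. *)
have pE : p = (ones t *+ (K2 - K1))%MM.
  apply: stdU; [exact: ft'|exact/ft/ones_supported|].
  apply: (addrI (multideg A (f K1))); rewrite -multidegD -fE !(fP _).1.
  rewrite !multidegD !multidegMn addrAC -mulrnDr subnKC //; exact: ltnW.
have tt' : t \subset t'.
  apply/fintype.subsetP => k kt; apply: contraLR (kt) => /tp.
  rewrite pE mulmnE mnmE => /eqP.
  by rewrite muln_eq0 -[_ == 0%N in X in _ || X]leqn0 leqNgt subn_gt0 K12 orbF eqb0.
have t'E := mt _ ft' tt'; subst t'.
exists w; split=> //.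
(* The part of [f K1] on [t] is moved to the other side of the degree equation. *)
exists (mcol R (ones t *+ K1)%MM - mcol R (mrestrict t (f K1))); split.
  apply: csupportedB; apply: mcol_supported.
    exact: ones_supported.
  exact: mrestrict_supported.
have f1E : f K1 = (w + mrestrict t (f K1))%MM.
  apply/mnmP => k; rewrite mnmDE mnmE; case: ifPn => kt.
    by rewrite sw // inE negbK.
  by rewrite addn0 fw.
have /(multideg_realP R) h := (fP K1).1.
rewrite f1E !mcolD !mulmxDr in h.
rewrite mulmxBr addrCA addrA -[LHS](addrK (AR *m mcol R (mrestrict t (f K1)))).
rewrite h; congr (_ - _); congr (_ + _).
by rewrite -!real_multideg multidegMn raddfMn /= -scaler_nat.
Qed.

(* Along [w_j + N^t], [j] growing, maximality of [t] forces a repetition among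
   the [w_j]. *)
Lemma facet_span (t : {set 'I_n}) (i : 'I_n) :
  t \in facets std ->
  exists c, csupported t c /\ AR *m mcol R U_(i)%MM = AR *m c.
Proof.
have [dst stdE stdU] := std_virtual.
move=> ft; have /choice[g gP] j := facet_translate i j ft.
move: ft => /facetsP[ft mt].
(* The limit argument is applied to the translates of [N^t] that stay standard, themselves indexed
   by an order ideal. *)
pose std' w := forall p, supported t p -> std (w + p)%MM.
have dst' : order_ideal std'.
  move=> u v uv p /uv; rewrite -addmA (addmC v) addmA; exact: dst.
have gstd' j : std' (g j) by have [] := gP j.
have [t' [w [_ wt lim]]] := order_ideal_limit dst' gstd'.
(* The exponents [w + p + q] with [p] on [t'] and [q] on [t] are standard, so [t :|: t'] is a face
   containing the facet [t]. *)
have t't : t' \subset t.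
  suff <- : t :|: t' = t by exact: finset.subsetUr.
  apply: mt; last exact: finset.subsetUl.
  move=> u su.
  have := wt _ (@mrestrict_supported _ t' u) _ (@mrestrict_supported _ t u).
  apply: (order_idealP dst) => k; rewrite !mnmDE !mnmE.
  have [kt|kt] := boolP (k \in t); first by rewrite leq_addl.
  have [kt'|kt'] := boolP (k \in t'); first by rewrite addn0 leq_addl.
  by rewrite su // inE negb_or kt kt'.
have [K1 [K2 [/andP[_ K12] _ [p tp gE]]]] := lim 0%N.
(* The two differ by an exponent on [t], where both vanish. *)
have gK : g K2 = g K1.
  apply/mnmP => k; rewrite gE mnmDE; have [kt|kt] := boolP (k \in t).
    have [s2 _ _] := gP K2.
    have := s2 k; rewrite gE mnmDE inE negbK => /(_ kt)/eqP.
    by rewrite addn_eq0 => /andP[/eqP-> /eqP->].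
  by rewrite tp ?addn0 //; apply: contra kt; apply: (fintype.subsetP t't).
have [_ _ [c1 [tc1 E1]]] := gP K1.
have [_ _ [c2 [tc2 E2]]] := gP K2.
have K0 : ((K2 - K1)%:R : R) != 0 by rewrite pnatr_eq0 subn_eq0 -ltnNge.
(* Subtracting the degree equations of [g K1] and [g K2] leaves [K2 - K1] times the column [a_i] in
   the span of [t]. *)
exists ((K2 - K1)%:R^-1 *: (c1 - c2)); split.
  by move=> k kt; rewrite mxE (csupportedB tc1 tc2 kt) mulr0.
rewrite -scalemxAr; apply: (scalerI K0); rewrite scalerA divff // scale1r.
rewrite natrB ?(ltnW K12) // scalerBl mulmxBr.
move: E2; rewrite gK E1 => E.
by apply: (addIr (AR *m c2)); rewrite subrK addrAC -E addrAC subrr add0r.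
Qed.

End FacetSpan.

(** * Gale duality over the reals *)

Section Gale.
Variables (R : realType) (m n d : nat) (B : 'M[int]_(m, n)) (A : 'M[int]_(d, n)).
Hypothesis galeBA : gale_dual B A.
Local Notation AR := (map_mx (intr : int -> R) A).
Local Notation BR := (map_mx (intr : int -> R) B).

(** Integer kernel vectors span the real kernel, and each of them is an integer combination of the
    rows of [B]. *)
Lemma gale_real_kernel (x : 'cV[R]_n) :
  AR *m x = 0 -> exists y : 'rV[R]_m, x^T = y *m BR.
Proof.
move=> Ax; have [K [AK xK]] := int_kernel R A.
have /choice[Y YE] j : exists y : 'rV[int]_m, (col j K)^T = y *m B.
  by apply/galeBA; rewrite colE mulmxA AK mul0mx.
have KE : K^T = (\matrix_j Y j) *m B.
  by apply/row_matrixP => j; rewrite row_mul rowK -YE tr_col.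
have [y xE] := xK _ Ax; exists (y^T *m map_mx intr (\matrix_j Y j)).
by rewrite xE trmx_mul -mulmxA -map_mxM -KE map_trmx.
Qed.

Lemma gale_orthogonal : A *m B^T = 0.
Proof.
apply/matrixP => i j.
have : A *m (row j B)^T = 0.
  apply/galeBA; exists (delta_mx 0 j); by rewrite trmxK rowE.
move/colP/(_ i); rewrite !mxE => h; rewrite -[RHS]h.
by apply: eq_bigr => k _; rewrite !mxE.
Qed.

Lemma real_gale_orthogonal (y : 'rV[R]_m) : AR *m (y *m BR)^T = 0.
Proof.
by rewrite trmx_mul mulmxA map_trmx -map_mxM gale_orthogonal map_mx0 mul0mx.
Qed.

(** Generating the lattice gives [B] a right inverse, hence rank [m]; its row space is the kernel of
    [A]. *)
Lemma gale_rank : generates_lattice B -> \rank AR = (n - m)%N.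
Proof.
move=> gB; have /choice[L LE] j : exists l : 'cV[int]_n, (delta_mx j 0 : 'cV_m) = B *m l.
  exact: gB.
have freeB : row_free BR.
  apply/row_freeP; exists (map_mx intr (\matrix_(i, j) L j i 0)).
  rewrite -map_mxM -[RHS](map_mx1 (intr : int -> R)); congr map_mx.
  apply/matrixP => i j; have /colP/(_ i) := LE j.
  rewrite !mxE andbT => h; apply: (etrans _ (esym h)).
  by apply: eq_bigr => k _; rewrite !mxE.
have kerE : (kermx AR^T :=: BR)%MS.
  apply/eqmxP/andP; split.
    apply/row_subP => i; have /sub_kermxP : (row i (kermx AR^T) <= kermx AR^T)%MS.
      exact: row_sub.
    move=> /(congr1 trmx); rewrite trmx_mul trmxK trmx0.
    by move/gale_real_kernel => [y]; rewrite trmxK => ->; exact: submxMl.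
  apply/row_subP => i; apply/sub_kermxP.
  by rewrite rowE -[LHS]trmxK trmx_mul trmxK real_gale_orthogonal trmx0.
have := mxrank_ker AR^T; rewrite kerE (eqP freeB) mxrank_tr => ->.
by rewrite subKn // rank_leq_col.
Qed.

End Gale.

Lemma facets_triangulation (R : realType) m n (B : 'M[int]_(m, n))
    (A : 'M[int]_(n - m, n)) (std : 'X_{1..n} -> Prop) :
  generates_lattice B -> gale_dual B A -> virtual_std A std ->
  triangulation R A (facets std).
Proof.
move=> gB galeBA vstd; split.
- move=> t tF; have /facetsP[ft _] := tF.
  have fX := std_face_free R vstd ft; split=> //.
  (* Full row rank makes the columns of [A] span everything; [facet_span] rewrites each of them
     through [t], so the free family of [t] is a basis and has [n - m] elements. *)
  have /row_freeP[C AC] : row_free (map_mx (intr : int -> R) A).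
    by rewrite /row_free (gale_rank R galeBA gB).
  have /choice[e eP] i := facet_span R vstd i tF.
  have spanX : <<[seq real_col R A i | i <- enum t]>>%VS = fullv.
    apply/eqP; rewrite eqEsubv subvf; apply/subvP => v _.
    pose c := C *m v; pose c' := \sum_i c i 0 *: e i.
    have tc' : csupported t c'.
      move=> k kt; rewrite summxE big1 // => i _.
      by rewrite mxE (eP i).1 // mulr0.
    have -> : v = map_mx intr A *m c'.
      rewrite -[LHS]mul1mx -AC -mulmxA -/c mulmx_sumr.
      have -> : c = \sum_i c i 0 *: mcol R U_(i)%MM.
        apply/colP => k; rewrite summxE (bigD1 k) //= big1 ?addr0.
          by rewrite !mxE mnm1E eqxx mulr1.
        by move=> i /negPf ik; rewrite !mxE mnm1E ik mulr0.
      rewrite mulmx_sumr; apply: eq_bigr => i _.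
      rewrite -!scalemxAr (eP i).2; congr (_ *: _).
      rewrite summxE (bigD1 i) //= big1 ?addr0; first by rewrite !mxE mnm1E eqxx mulr1.
      by move=> k /negPf ki; rewrite !mxE mnm1E ki mulr0.
    have := sum_real_cols A t (fun i => c' i 0).
    have -> : \col_i c' i 0 = c' by apply/colP => i; rewrite mxE.
    rewrite (mask_id tc') => <-; apply: memv_suml => i it; apply: memvZ.
    by apply: memv_span; apply: map_f; rewrite mem_enum.
  move: fX; rewrite /free spanX dimvf /= size_map -cardE => /eqP <-.
  by rewrite /dim /= muln1.
- move=> s t [s' /facetsP[fs _] ss'] [t' /facetsP[ft _] tt'].
  apply: (std_faces_meet R vstd) => u.
    by move=> /(supportedW ss'); apply: fs.
  by move=> /(supportedW tt'); apply: ft.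
- apply/seteqP; split=> v.
    by move=> [t _]; apply: cone_subset; exact: finset.subsetT.
  by move=> /(std_faces_cover vstd)[t tF tv]; exists t.
Qed.

(** * Integral vertices of fibres *)

(** Different coordinates may attain their minimum at different monomials, so [h] need not lie in
    the fibre. *)
Definition fibre_gcd d n (A : 'M[int]_(d, n)) (u h : 'X_{1..n}) :=
  (forall v, multideg A v = multideg A u -> forall i, (h i <= v i)%N) /\
  (forall i, exists v, multideg A v = multideg A u /\ v i = h i).

Lemma fibre_gcd_exists d n (A : 'M[int]_(d, n)) (u : 'X_{1..n}) :
  exists h, fibre_gcd A u h.
Proof.
have /choice[h hP] i : exists a, (forall v, multideg A v = multideg A u ->
    (a <= v i)%N) /\ exists v, multideg A v = multideg A u /\ v i = a.
  pose P a := `[< exists v, multideg A v = multideg A u /\ v i = a >].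
  have exP : exists a, P a by exists (u i); apply/asboolP; exists u.
  case: (ex_minnP exP) => a /asboolP Pa mina; exists a; split=> // v uv.
  by apply: mina; apply/asboolP; exists v.
exists [multinom h i | i < n]; split=> [v uv i|i]; rewrite mnmE.
  by have [+ _] := hP i; apply.
by have [] := hP i.
Qed.

Lemma fibre_gcd_unique d n (A : 'M[int]_(d, n)) (u v h h' : 'X_{1..n}) :
  multideg A u = multideg A v -> fibre_gcd A u h -> fibre_gcd A v h' -> h = h'.
Proof.
move=> uv [h1 h2] [h1' h2']; apply/mnmP => i; apply/eqP; rewrite eqn_leq.
have [w [wu wh]] := h2 i; have [w' [wv wh']] := h2' i.
by rewrite -wh' h1 ?uv // wh' -wh h1' // -uv.
Qed.

Lemma fibre_gcd_sub d n (A : 'M[int]_(d, n)) (u h v : 'X_{1..n}) :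
  fibre_gcd A u h -> multideg A v = multideg A u -> (v - h + h)%MM = v.
Proof. by move=> [h1 _] vu; apply: submK; apply/mnm_lepP => i; apply: h1. Qed.

Section Integrality.
Variables (R : realType) (m n d : nat) (B : 'M[int]_(m, n)) (A : 'M[int]_(d, n)).
Hypotheses (snB : supernormal R B) (galeBA : gale_dual B A).
Local Notation AR := (map_mx (intr : int -> R) A).
Local Notation BR := (map_mx (intr : int -> R) B).

(* The rational point of a fibre on a simplicial cone [s] is a vertex of the
   polyhedron of the fibre.  When no variable divides all the monomials of the
   fibre, every constraint [b_j] in the cone over the complement of [s] is tight
   there, so that supernormality makes this vertex integral. *)
Lemma fibre_vertex_integral (s : {set 'I_n}) (u : 'X_{1..n}) (r : 'cV[R]_n) :
  free [seq real_col R A i | i <- enum s] ->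
  (forall i, exists v, multideg A v = multideg A u /\ v i = 0%N) ->
  nonneg r -> csupported s r -> AR *m r = AR *m mcol R u ->
  exists v, supported s v /\ multideg A v = multideg A u.
Proof.
move=> /free_colsP fs gcd0 r0 sr Aru.
have galeE (v : 'X_{1..n}) : multideg A v = multideg A u ->
    exists y : 'rV[R]_m, (r - mcol R v)^T = y *m BR.
  move=> /(multideg_realP R) vu.
  by apply: (gale_real_kernel galeBA); rewrite mulmxBr Aru vu subrr.
have mul_real_col (y : 'rV[R]_m) j : (y *m real_col R B j) 0 0 = (y *m BR) 0 j.
  by rewrite !mxE; apply: eq_bigr => k _; rewrite !mxE.
(* Take [v] in the fibre with [v j = 0]. Then [r j] is [y] applied to [b_j], a non-negative
   combination of the values of [y] on [b_i] for [i] outside [s]; these equal [- v i], so [r j] is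
   at most zero. *)
have tight j : cone B (~: s)%SET (real_col R B j) -> r j 0 = 0.
  move=> /coneP[l [l0 sl jE]]; have [v [vu vj]] := gcd0 j.
  have [y yE] := galeE v vu.
  have rvE i : (y *m BR) 0 i = r i 0 - (v i)%:R by rewrite -yE !mxE.
  have : (y *m real_col R B j) 0 0 = r j 0.
    by rewrite mul_real_col rvE vj subr0.
  rewrite jE mulmxA mxE => rj; apply/eqP; rewrite eq_le r0 andbT -rj.
  apply: sumr_le0 => i _; rewrite rvE; have [si|si] := boolP (i \in s).
    by rewrite sl ?mulr0 // inE si.
  by rewrite sr // sub0r mulNr oppr_le0 mulr_ge0.
have [y yE] := galeE u erefl.
have ruE i : (y *m BR) 0 i = r i 0 - (u i)%:R by rewrite -yE !mxE.
(* For large [N], [b_k] plus [N] times the sum of the [b_i] off [s] lies in the cone over the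
   complement of [s]. Supernormality rewrites it through vectors of that cone, on which [r] is
   tight; applying [y] to both expressions shows that [r k] is an integer. *)
have integral k : exists a : nat, r k 0 = a%:R.
  (* The columns of [B] off [s] span: a functional killing them would give a kernel vector of [A]
     supported on the independent set [s]. *)
  have [c [sc kE]] : exists c, csupported (~: s)%SET c /\ real_col R B k = BR *m c.
    have [//|[f [f0 f1]]] := span_separation BR (~: s)%SET (real_col R B k).
    have : (f *m BR)^T = 0.
      apply: fs; last exact: real_gale_orthogonal.
      move=> i si; pose e : 'cV[R]_n := delta_mx i 0.
      have := f0 e; rewrite mulmxA -colE !mxE; apply=> j.
      by rewrite inE negbK !mxE andbT; case: eqP si => // -> /negPf ->.
    move=> /colP/(_ k); rewrite mxE -mul_real_col f1 mxE => /eqP.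
    by rewrite oner_eq0.
  have [|N hN] := @eventually_forall 'I_n (fun i N => 0 <= c i 0 + N%:R).
    move=> i; have [|N0 hN0] := @sum_le_archi R 1 (- c i 0); first exact: ltr01.
    by exists N0 => N /hN0; rewrite mulr1 -subr_gt0 opprK addrC => /ltW.
  have {hN} := hN N (leqnn N) => hN.
  (* Integer combinations of the [b_i] are handled as exponents, with [multideg B] as their
     value. *)
  pose e : 'X_{1..n} := (U_(k) + ones (~: s)%SET *+ N)%MM.
  have eE i : mcol R e i 0 = (i == k)%:R + (i \notin s)%:R * N%:R.
    by rewrite mxE mnmDE mulmnE mnm1E mnmE natrD natrM eq_sym inE.
  have [cc [cc0 zE]] : exists cc : 'I_n -> nat,
      (forall i, ~ cone B (~: s)%SET (real_col R B i) -> cc i = 0%N) /\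
      multideg B e = \sum_i col i B *+ cc i.
    apply: snB; apply/coneP.
    exists (\col_i (if i \in s then 0 else c i 0 + N%:R)); split.
    - by move=> i; rewrite mxE; case: ifP.
    - by move=> i; rewrite inE negbK mxE => ->.
    rewrite real_multideg.
    have -> : mcol R e = delta_mx k 0 + \col_i ((i \notin s)%:R * N%:R).
      by apply/colP => i; rewrite eE !mxE andbT.
    rewrite mulmxDr -colE -map_col -/(real_col R B k) kE -mulmxDr.
    congr (_ *m _); apply/colP => i; rewrite !mxE.
    by case: ifPn => si; [rewrite sc ?inE ?si // mul0r addr0|rewrite mul1r].
  pose e' : 'X_{1..n} := [multinom cc i | i < n].
  have ee' : BR *m mcol R e = BR *m mcol R e'.
    apply/(multideg_realP R); rewrite zE; apply: eq_bigr => i _.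
    by rewrite mnmE.
  have /matrixP/(_ 0 0) : (y *m BR) *m mcol R e = (y *m BR) *m mcol R e'.
    by rewrite -!mulmxA ee'.
  rewrite [LHS]mxE [RHS]mxE.
  have sumE (x : 'X_{1..n}) : \sum_j (y *m BR) 0 j * mcol R x j 0 =
      \sum_j r j 0 * mcol R x j 0 - (\sum_j u j * x j)%N%:R.
    rewrite natr_sum -sumrB; apply: eq_bigr => j _.
    by rewrite ruE mulrBl natrM [mcol R x j 0]mxE.
  rewrite !sumE.
  have -> : \sum_j r j 0 * mcol R e j 0 = r k 0.
    rewrite (bigD1 k) //= big1 => [|i /negPf ik].
      rewrite eE eqxx mulrDr mulr1 addr0.
      by case: (boolP (k \in s)) => [|/sr ->]; rewrite ?mul0r ?mulr0 addr0.
    rewrite eE ik add0r.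
    by case: (boolP (i \in s)) => [|/sr ->]; rewrite ?mul0r ?mulr0.
  rewrite [X in _ = X - _]big1 => [|i _]; last first.
    rewrite mxE mnmE; have [/tight->|/cc0->] :=
      pselect (cone B (~: s)%SET (real_col R B i)); by rewrite ?mul0r ?mulr0.
  rewrite sub0r => /eqP; rewrite subr_eq addrC => /eqP rk.
  have := r0 k; rewrite rk subr_ge0 ler_nat => le.
  (* Since [r k] is non-negative, this natural subtraction does not truncate. *)
  exists (\sum_j u j * e j - \sum_j u j * e' j)%N.
  by rewrite natrB.
have /choice[v vE] := integral.
have rE : r = mcol R [multinom v i | i < n].
  by apply/colP => i; rewrite mxE mnmE.
exists [multinom v i | i < n]; split=> [i si|].
  by apply/eqP; rewrite -(eqr_nat R) mnmE -vE sr.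
by apply/(multideg_realP R); rewrite -rE.
Qed.

(** Dividing the fibre by [x^h] makes its gcd trivial, and the degree of [u - h] lies in some cone
    of [D], so [fibre_vertex_integral] applies. *)
Lemma triangulated_fibre (D : {set {set 'I_n}}) (u h : 'X_{1..n}) :
  triangulation R A D -> fibre_gcd A u h ->
  exists s v, [/\ s \in D, supported s v & multideg A (h + v)%MM = multideg A u].
Proof.
move=> [freeD _ coverD] hu; have [h1 h2] := hu.
have : cone A [set: 'I_n]%SET (AR *m mcol R (u - h)%MM).
  apply/coneP; exists (mcol R (u - h)%MM); split=> //; first exact: mcol_nonneg.
  by move=> i; rewrite inE.
rewrite -coverD => -[s sD /coneP[r [r0 sr rE]]].
have uE := fibre_gcd_sub hu erefl.
have [||v [sv vE]] := @fibre_vertex_integral s (u - h)%MM r _ _ r0 sr (esym rE).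
- by have [] := freeD s sD.
- move=> i; have [v [vu vh]] := h2 i; exists (v - h)%MM; split.
    apply: (addIr (multideg A h)).
    by rewrite -!multidegD uE (fibre_gcd_sub hu).
  by rewrite mnmBE vh subnn.
exists s, v; split=> //.
by rewrite multidegD vE -multidegD addmC uE.
Qed.

(** As a divisor of [u], [u - h] is standard; [v] is standard and has the same degree. *)
Lemma std_normal_form (std : 'X_{1..n} -> Prop)
    (u h v : 'X_{1..n}) (s : {set 'I_n}) :
  virtual_std A std -> fibre_gcd A u h -> std_face std s -> supported s v ->
  multideg A (h + v)%MM = multideg A u -> std u -> u = (h + v)%MM.
Proof.
move=> [dst _ stdU] hu fs sv hvu stdu.
have uE := fibre_gcd_sub hu erefl.
suff <- : (u - h)%MM = v by rewrite addmC.
apply: stdU; [by apply: (dst _ h); rewrite uE|exact: fs|].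
by apply: (addrI (multideg A h)); rewrite -!multidegD hvu addmC uE.
Qed.

Lemma facets_determine_std (std std' : 'X_{1..n} -> Prop) (u : 'X_{1..n}) :
  triangulation R A (facets std) -> virtual_std A std -> virtual_std A std' ->
  facets std = facets std' -> std u -> std' u.
Proof.
move=> tri vstd vstd' FF stdu.
have [h hu] := fibre_gcd_exists A u.
have [s [v [sF sv hvu]]] := triangulated_fibre tri hu.
have [_ stdE' _] := vstd'; have [w [wu stdw]] := stdE' u.
have hw : fibre_gcd A w h by rewrite /fibre_gcd wu.
have [/facetsP[fs _] /facetsP[fs' _]] : s \in facets std /\ s \in facets std'.
  by rewrite -FF.
rewrite (std_normal_form vstd hu fs sv hvu stdu).
by rewrite -(std_normal_form vstd' hw fs' sv _ stdw) // hvu.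
Qed.

(** The inverse construction: the normal forms of [triangulated_fibre] are declared standard. *)
Definition triangulation_std (D : {set {set 'I_n}}) (u : 'X_{1..n}) :=
  exists h, fibre_gcd A u h /\ exists2 s, s \in D & supported s (u - h)%MM.

(** Closure under divisors holds because multiplying a fibre by [v] raises its gcd by at most [v].
    For uniqueness, two normal forms give one point in two cones, hence in their common face, and
    coordinates on a simplicial cone are unique. *)
Lemma triangulation_std_virtual (D : {set {set 'I_n}}) :
  triangulation R A D -> virtual_std A (triangulation_std D).
Proof.
move=> tri; have [freeD meetD coverD] := tri; split.
- move=> u v [h [[h1 h2] [s sD su]]].
  have [h' h'u] := fibre_gcd_exists A u; exists h'; split=> //.
  exists s => // i si; have [_ h'2] := h'u.
  have [w [wu wh]] := h'2 i.
  have := su i si; rewrite !mnmBE mnmDE => /eqP; rewrite subn_eq0 => uvh.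
  apply/eqP; rewrite subn_eq0 -wh -(leq_add2r (v i)) (leq_trans uvh) //.
  by rewrite -mnmDE h1 // !multidegD wu.
- move=> u; have [h hu] := fibre_gcd_exists A u.
  have [s [v [sD sv hvu]]] := triangulated_fibre tri hu.
  exists (h + v)%MM; split=> //; exists h; split; first by rewrite /fibre_gcd hvu.
  by exists s => //; rewrite addmC addmK.
move=> u v [h [hu [s sD su]]] [h' [hv [t tD tv]]] uv.
have hh' := fibre_gcd_unique uv hu hv; subst h'.
have uE := fibre_gcd_sub hu erefl; have vE := fibre_gcd_sub hv erefl.
rewrite -uE -vE; congr (_ + _)%MM.
have AE : AR *m mcol R (u - h)%MM = AR *m mcol R (v - h)%MM.
  apply/multideg_realP; apply: (addIr (multideg A h)).
  by rewrite -!multidegD uE vE.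
have inD x : x \in D -> faces D x by move=> xD; exists x.
have : (cone A s `&` cone A t)%classic (AR *m mcol R (u - h)%MM).
  split; apply/coneP; [exists (mcol R (u - h)%MM)|exists (mcol R (v - h)%MM)];
    split=> //; by [exact: mcol_nonneg|exact: mcol_supported].
rewrite (meetD _ _ (inD s sD) (inD t tD)) => /coneP[c [_ stc cE]].
have eqc x y : x \in D -> csupported x c -> supported x y ->
    AR *m mcol R y = AR *m c -> mcol R y = c.
  move=> xD xc xy yc; have [_ /free_colsP fx] := freeD x xD.
  apply/eqP; rewrite -subr_eq0; apply/eqP; apply: fx.
    by apply: csupportedB xc; apply: mcol_supported.
  by rewrite mulmxBr yc subrr.
apply: (@mcol_inj R); rewrite (eqc s) //; last first.
  by apply: csupportedW stc; apply: finset.subsetIl.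
rewrite (eqc t) // -?AE //.
by apply: csupportedW stc; apply: finset.subsetIr.
Qed.

(** For a face [t], the sum of its vectors lies in a cone [s] of [D]; by [std_faces_conflict] its
    coordinates there are [ones t], so [t] lies in [s]. The members of [D] all have the same
    cardinality, so each is maximal. *)
Lemma facets_triangulation_std (D : {set {set 'I_n}}) :
  triangulation R A D -> facets (triangulation_std D) = D.
Proof.
move=> tri; have [freeD meetD coverD] := tri.
have vstd := triangulation_std_virtual tri.
have fD s : s \in D -> std_face (triangulation_std D) s.
  move=> sD u su; have [h hu] := fibre_gcd_exists A u.
  by exists h; split=> //; exists s => // i /su ui; rewrite mnmBE ui.
have subD t : std_face (triangulation_std D) t -> exists2 s, s \in D & t \subset s.
  move=> ft; have t1 : supported t (ones t) by move=> i /negPf it; rewrite mnmE it.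
  have : cone A [set: 'I_n]%SET (AR *m mcol R (ones t)).
    apply/coneP; exists (mcol R (ones t)); split=> //; first exact: mcol_nonneg.
    by move=> i; rewrite inE.
  rewrite -coverD => -[s sD /coneP[r [r0 sr rE]]]; exists s => //.
  have rt := std_faces_conflict vstd ft (fD s sD) (@mcol_nonneg R _ _) r0
    (mcol_supported R t1) sr rE.
  apply/fintype.subsetP => i it; apply: contraT => /sr.
  by rewrite -rt mxE mnmE it => /eqP; rewrite oner_eq0.
apply/setP => t; apply/facetsP/idP => [[ft mt]|tD].
  have [s sD ts] := subD t ft.
  by rewrite -(mt s (fD s sD) ts).
split; first exact: fD.
move=> t' ft' tt'; have [s sD t's] := subD t' ft'.
have ts : t = s.
  apply/eqP; rewrite eqEcard (fintype.subset_trans tt' t's) /=.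
  by have [-> _] := freeD t tD; have [-> _] := freeD s sD.
by apply/eqP; rewrite finset.eqEsubset tt' ts t's.
Qed.

End Integrality.

(** * Monomial ideals and their minimal primes *)

Local Open Scope classical_set_scope.

Lemma ideal_gen_ideal (S : comNzRingType) (G : set S) : is_ideal (ideal_gen G).
Proof.
split=> [X [[X0 _ _] _]//|f g fG gG X XG|h f fG X XG].
  by have [[_ XD _] _] := XG; apply: XD; [exact: fG|exact: gG].
by have [[_ _ XM] _] := XG; apply: XM; exact: fG.
Qed.

Lemma prime_prod (S : comNzRingType) (P : set S) (I : Type) (r : seq I)
    (F : I -> S) :
  is_prime P -> P (\prod_(i <- r) F i) -> exists i, P (F i).
Proof.
move=> [_ P1 PM]; elim: r => [|i r IH]; first by rewrite big_nil.
by rewrite big_cons => /PM[Pi|//]; exists i.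
Qed.

Lemma prime_exp (S : comNzRingType) (P : set S) (x : S) e :
  is_prime P -> P (x ^+ e) -> (0 < e)%N /\ P x.
Proof.
move=> [_ P1 PM]; elim: e => [|e IH]; first by rewrite expr0.
by rewrite exprS => /PM[//|/IH[]].
Qed.

Section MonomialIdeals.
Variables (k : fieldType) (n : nat).
Implicit Types (M P : set {mpoly k[n]}) (s : {set 'I_n}) (u : 'X_{1..n}).

(** Makes a monomial ideal a function of its monomials, as injectivity requires. *)
Lemma monomial_ideal_gen M :
  monomial_ideal M -> M = ideal_gen [set 'X_[u] | u in [set u | M 'X_[u]]].
Proof.
move=> [G ME]; apply/seteqP; split.
  rewrite {1}ME; apply: smallest_sub; first exact: ideal_gen_ideal.
  move=> _ [u Gu <-]; apply: sub_gen_smallest; exists u => //.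
  by rewrite /= ME; apply: sub_gen_smallest; exists u.
apply: smallest_sub; first by rewrite ME; exact: ideal_gen_ideal.
by move=> _ [u Mu <-].
Qed.

Lemma monomial_ideal_closed M u v :
  monomial_ideal M -> M 'X_[u] -> M 'X_[u + v].
Proof.
move=> [G ->] Mu.
have [_ _ IM] := ideal_gen_ideal [set ('X_[u] : {mpoly k[n]}) | u in G].
by rewrite addmC mpolyXD; exact: IM.
Qed.

(** The polynomials whose support lies in the upward closed set [N] form an ideal containing the
    generators. *)
Lemma monomials_of_gen (N : set 'X_{1..n}) u :
  (forall v w, N v -> N (v + w)%MM) ->
  ideal_gen [set ('X_[v] : {mpoly k[n]}) | v in N] 'X_[u] -> N u.
Proof.
move=> Nup.
suff sub : ideal_gen [set ('X_[v] : {mpoly k[n]}) | v in N] `<=`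
    [set f : {mpoly k[n]} | forall v, v \in msupp f -> N v].
  by move=> /sub; apply; rewrite msuppX inE.
apply: smallest_sub => [|_ [v Nv <-] w]; last by rewrite msuppX inE => /eqP->.
split=> [v|f g fN gN v|h f fN v] /=; first by rewrite msupp0.
  by move=> /msuppD_le; rewrite mem_cat => /orP[/fN|/gN].
by move=> /msuppM_le/allpairsP[[v1 v2] [_ /= /fN v2N ->]]; rewrite addmC; apply: Nup.
Qed.

Lemma mpolyX_neq0 u : 'X_[u] <> 0 :> {mpoly k[n]}.
Proof.
move=> /(congr1 (mcoeff u))/eqP.
by rewrite mcoeffX eqxx mcoeff0 oner_eq0.
Qed.

(** The substitution whose kernel is [var_ideal s]; as the polynomial ring is a domain, this kernel
    is prime. *)
Definition kill_vars s (f : {mpoly k[n]}) : {mpoly k[n]} :=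
  f \mPo [tuple (if i \in s then 0 else 'X_i : {mpoly k[n]}) | i < n].

Lemma kill_vars_id s u : supported (~: s)%SET u -> kill_vars s 'X_[u] = 'X_[u].
Proof.
move=> su; rewrite /kill_vars comp_mpolyX [RHS]mpolyXE_id.
apply: eq_bigr => i _; rewrite tnth_mktuple; case: ifPn => // si.
by rewrite su ?expr0 // inE si.
Qed.

Lemma kill_vars0 s u i : i \in s -> u i != 0%N -> kill_vars s 'X_[u] = 0.
Proof.
move=> si ui; rewrite /kill_vars comp_mpolyX (bigD1 i) //= tnth_mktuple si.
by rewrite expr0n (negPf ui) mul0r.
Qed.

Lemma var_ideal_monomial s u i :
  i \in s -> u i != 0%N -> @var_ideal k n s 'X_[u].
Proof.
move=> si ui; have -> : u = (u - U_(i) + U_(i))%MM.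
  by rewrite submK // lep1mP.
have [_ _ IM] := ideal_gen_ideal [set ('X_i : {mpoly k[n]}) | i in [set` s]].
by rewrite mpolyXD; apply: IM; apply: sub_gen_smallest; exists i.
Qed.

Lemma var_idealE s : @var_ideal k n s = [set f | kill_vars s f = 0].
Proof.
have [I0 ID IM] := ideal_gen_ideal [set ('X_i : {mpoly k[n]}) | i in [set` s]].
apply/seteqP; split.
  apply: smallest_sub => [|_ [i si <-]].
    split=> [|f g|h f] /=; rewrite /kill_vars ?comp_mpoly0 ?comp_mpolyD //.
      by move=> -> ->; rewrite addr0.
    by rewrite rmorphM /= => ->; rewrite mulr0.
  by apply: (@kill_vars0 _ _ i) => //; rewrite mnm1E eqxx.
(* Modulo the ideal [f] agrees with [kill_vars s f]: each monomial is either fixed or sent to zero,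
   the latter only if it involves a variable of [s]. *)
move=> f /= kf; have -> : f = f - kill_vars s f by rewrite kf subr0.
have kE : kill_vars s f = \sum_(u <- msupp f) f@_u *: kill_vars s 'X_[u].
  rewrite {1}[f]mpolyE /kill_vars raddf_sum /=.
  by apply: eq_bigr => u _; rewrite linearZ.
rewrite {1}[f]mpolyE kE -sumrB.
elim: (msupp f) => [|u r IH]; first by rewrite big_nil.
rewrite big_cons; apply: ID => //.
rewrite -scalerBr -mul_mpolyC; apply: IM.
have [su|] := pselect (supported (~: s)%SET u).
  by rewrite kill_vars_id // subrr.
move=> /existsNP[i /not_implyP[]]; rewrite inE negbK => si /eqP ui.
rewrite (kill_vars0 si ui) subr0.
exact: var_ideal_monomial si ui.
Qed.

Lemma var_ideal_prime s : is_prime (@var_ideal k n s).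
Proof.
split; first exact: ideal_gen_ideal.
  by rewrite var_idealE /= /kill_vars rmorph1 => /eqP; rewrite oner_eq0.
move=> f g; rewrite var_idealE /= /kill_vars rmorphM => /eqP.
by rewrite mulf_eq0 => /orP[] /eqP; [left|right].
Qed.

Lemma var_ideal_var s i : @var_ideal k n s 'X_i <-> i \in s.
Proof.
split=> [|si]; last by apply: (var_ideal_monomial si); rewrite mnm1E eqxx.
apply: contraPT => si; rewrite var_idealE /= kill_vars_id.
  exact: mpolyX_neq0.
move=> j; rewrite inE negbK mnm1E => js; case: eqP => // ij.
by rewrite ij js in si.
Qed.

Lemma sub_var_ideal M s : monomial_ideal M ->
  M `<=` @var_ideal k n s <-> std_face (fun u => ~ M 'X_[u]) (~: s)%SET.
Proof.
move=> Mmon; split=> [Ms u su /Ms|fs].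
  by rewrite var_idealE /= kill_vars_id // => /mpolyX_neq0.
rewrite (monomial_ideal_gen Mmon); apply: smallest_sub.
  exact: ideal_gen_ideal.
move=> _ [u Mu <-].
have /existsNP[i /not_implyP[]] : ~ supported (~: s)%SET u by move/fs.
by rewrite inE negbK => si /eqP ui; exact: var_ideal_monomial si ui.
Qed.

(** Minimality need only be tested against ideals of variables: a prime containing M contains the
    ideal of its own variables, which already contains M. *)
Lemma var_minimal_primesE M : monomial_ideal M ->
  var_minimal_primes M =
  [set (~: t)%SET | t in facets (fun u => ~ M 'X_[u])]%SET.
Proof.
move=> Mmon; apply/setP => s.
rewrite -[s in RHS]finset.setCK (mem_imset _ _ (@finset.setC_inj _)).
rewrite inE; apply/asboolP/facetsP => [[_ Ms mins]|[fs maxs]].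
  split=> [|t' ft' st']; first exact/sub_var_ideal.
  have t's : (~: t')%SET \subset s by rewrite finset.subCset.
  suff sE : s = (~: t')%SET by rewrite sE finset.setCK.
  apply/setP => i; apply/idP/idP => /var_ideal_var; last first.
    by move=> /var_ideal_var/(fintype.subsetP t's).
  rewrite -(mins (@var_ideal k n (~: t')%SET)).
  - by move=> /var_ideal_var.
  - exact: var_ideal_prime.
  - by apply/sub_var_ideal; rewrite ?finset.setCK.
  apply: smallest_sub; first exact: ideal_gen_ideal.
  by move=> _ [j jt' <-]; apply/var_ideal_var; apply: (fintype.subsetP t's).
split; [exact: var_ideal_prime|exact/sub_var_ideal|].
move=> Q Qp MQ Qs; apply/seteqP; split=> //.
pose t : {set 'I_n} := [set i | `[< Q 'X_i >]]%SET.
(* A monomial of M is in [Q], so one of its variables is in [Q], that is, in [t]. *)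
have ft : std_face (fun u => ~ M 'X_[u]) (~: t)%SET.
  move=> u tu /MQ; rewrite mpolyXE_id => /(prime_prod Qp)[i].
  move=> /(prime_exp Qp)[ui Qi]; move: ui; rewrite tu //.
  by rewrite inE negbK inE; exact/asboolP.
have ts : t \subset s.
  apply/fintype.subsetP => i; rewrite inE => /asboolP/Qs.
  by move/var_ideal_var.
have tsE : t = s.
  by apply: finset.setC_inj; apply: maxs => //; rewrite finset.setCS.
apply: smallest_sub; first by have [] := Qp.
by move=> _ [i si <-]; move: si; rewrite /= -tsE inE => /asboolP.
Qed.

Lemma virtual_initial_std d (A : 'M[int]_(d, n)) M :
  virtual_initial_ideals k A M <->
  monomial_ideal M /\ virtual_std A (fun u => ~ M 'X_[u]).
Proof.
split=> -[Mmon H]; split=> //.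
  split=> [u v Muv Mu|u|u v Mu Mv uv].
  - by apply: Muv; exact: monomial_ideal_closed.
  - by have [|v [[vu Mv] _]] := H (multideg A u); [exists u|exists v].
  - have [|w [_ wU]] := H (multideg A v); first by exists v.
    by rewrite -(wU u) // -(wU v).
move=> _ [u _ <-]; have [_ stdE stdU] := H.
have [v [vu Mv]] := stdE u; exists v; split=> // w [wu Mw].
by apply: stdU => //; rewrite vu wu.
Qed.

Lemma virtual_initial_of_std d (A : 'M[int]_(d, n)) (std : 'X_{1..n} -> Prop) :
  virtual_std A std ->
  exists2 M, virtual_initial_ideals k A M & forall u, ~ M 'X_[u] <-> std u.
Proof.
move=> vstd; have [dstd _ _] := vstd.
pose M := ideal_gen [set ('X_[u] : {mpoly k[n]}) | u in [set u | ~ std u]].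
have stdM u : ~ M 'X_[u] <-> std u.
  split=> [Mu|stdu].
    by apply: contrapT => nu; apply: Mu; apply: sub_gen_smallest; exists u.
  by move=> /monomials_of_gen; apply => //= v w nv /dstd.
exists M => //; apply/virtual_initial_std; split; first by exists [set u | ~ std u].
suff -> : (fun u => ~ M 'X_[u]) = std by [].
by apply/funext => u; apply/propext.
Qed.

End MonomialIdeals.

(** * Bijectivity of the map from ideals to chambers *)

Theorem theorem1p2 (R : realType) (k : fieldType) (m n : nat)
    (B : 'M[int]_(m, n)) (A : 'M[int]_(n - m, n)) :
  supernormal R B ->
  generates_lattice B ->
  gale_dual B A ->
  set_bij (virtual_initial_ideals k A) (virtual_chambers R A)
    (@var_minimal_primes k n).
Proof.
move=> snB gB galeBA; split.
- move=> M /virtual_initial_std[Mmon Mstd].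
  rewrite (var_minimal_primesE Mmon); exists (facets (fun u => ~ M 'X_[u])) => //.
  exact: facets_triangulation gB galeBA Mstd.
- move=> M M' /set_mem/virtual_initial_std[Mmon Mstd].
  move=> /set_mem/virtual_initial_std[M'mon M'std].
  rewrite !var_minimal_primesE // => /(imset_inj (@finset.setC_inj _)) FF.
  have tri := facets_triangulation R gB galeBA Mstd.
  have tri' := facets_triangulation R gB galeBA M'std.
  (* Equality of the ideals reduces to equality of their monomials, obtained on the complements by
     contraposition. *)
  rewrite (monomial_ideal_gen Mmon) (monomial_ideal_gen M'mon).
  congr (ideal_gen (image _ _)); apply/seteqP; split=> u /=; apply: contraPP.
    exact: (facets_determine_std snB galeBA tri' M'std Mstd (esym FF)).
  exact: (facets_determine_std snB galeBA tri Mstd M'std FF).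
- move=> _ [D tri <-].
  have [M MV stdM] :=
    virtual_initial_of_std k (triangulation_std_virtual snB galeBA tri).
  exists M => //; have [Mmon _] := (virtual_initial_std A M).1 MV.
  rewrite (var_minimal_primesE Mmon).
  rewrite -[D in RHS](facets_triangulation_std snB galeBA tri).
  suff -> : (fun u => ~ M 'X_[u]) = triangulation_std A D by [].
  by apply/funext => u; apply/propext.
Qed.
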